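(* Let $p$ be a prime and let $G$ be a finite abelian $p$-group with $|G|>1$, say $G\cong \mathbb Z_{p^{k_1}}\oplus\cdots\oplus\mathbb Z_{p^{k_r}}$ with $1\le k_1\le\cdots\le k_r$, so that $\exp(G)=p^{k_r}$. Put $\mathsf d^*(G)=\sum_{t=1}^r(p^{k_t}-1)$. Let $A$ be a nonempty subset of $\{1,2,\ldots,p^{k_r}-1\}$ containing no multiple of $p$, and suppose any two distinct elements of $A$ are incongruent modulo $p$. Then, for each positive integer $k$, every sequence of elements of $G$ of length at least $p^k-1+\lceil(\mathsf d^*(G)+1)/|A|\rceil$ contains a nonempty $A$-weighted zero-sum subsequence whose length is divisible by $p^k$. Consequently, if $|A|\,(\exp(G)-1)\ge \mathsf d^*(G)=\mathsf D(G)-1$ (which holds in particular if $|A|\ge r$), then $$\mathsf s_A(G)\le \exp(G)-1+\left\lceil\frac{\mathsf D(G)}{|A|}\right\rceil.$$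
   Context: A sequence over $G$ is a finite (unordered) list $c_1,\ldots,c_m$ of elements of $G$, repetitions allowed; a subsequence is a sublist, and its length is its number of terms. For a set $A$ of integers, a sequence $c_1,\ldots,c_n$ is an $A$-weighted zero-sum sequence if there exist $a_1,\ldots,a_n\in A$ with $\sum_{i=1}^n a_ic_i=0$. $\mathsf s_A(G)$ is the least integer $m$ such that every sequence over $G$ of length at least $m$ has an $A$-weighted zero-sum subsequence of length $\exp(G)$. $\mathsf D(G)$ denotes the Davenport constant of $G$ (least $m$ such that every sequence of length $\ge m$ has a nonempty subsequence with sum $0$); for the $p$-group $G$ above it equals $\mathsf d^*(G)+1$. *)

(* Defs.v *)
From mathcomp Require Import all_boot all_order all_algebra all_fingroup.
From mathcomp Require Import all_solvable finmap boolp.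

Set Implicit Arguments.
Unset Strict Implicit.
Unset Printing Implicit Defensive.

Import GRing.Theory.

Local Open Scope ring_scope.

(* Unordered sequences over G are represented by lists: all the notions below
   are invariant under permutation of the list, so [subseq], which preserves
   the order, loses nothing. *)

Definition weighted_zero_sum (G : zmodType) (A : {fset int}) (c : seq G) :=
  exists w : 'I_(size c) -> int,
    (forall i, w i \in A) /\ \sum_(i < size c) c`_i *~ w i = 0.

Definition davenport_bound (G : finZmodType) (m : nat) :=
  forall s : seq G, (m <= size s)%N ->
    exists t : seq G, [/\ subseq t s, t != [::] & \sum_(x <- t) x = 0].

Definition weighted_bound (G : finZmodType) (A : {fset int}) (m : nat) :=
  forall s : seq G, (m <= size s)%N ->
    exists t : seq G,
      [/\ subseq t s, size t = exponent [set: G] & weighted_zero_sum A t].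

(* The two bounds exist, so that the least ones are defined by [ex_minn]
   without any default value. *)

Lemma constant_subseq (G : finZmodType) (n : nat) (s : seq G) :
  (n * #|G|.+1 <= size s)%N -> exists g, subseq (nseq n g) s.
Proof.
case: n => [|n] les; first by exists 0; rewrite sub0seq.
have [/existsP[g leg]|/existsPn few] :=
  boolP [exists g, (n < count_mem g s)%N].
  exists g; apply: (subseq_trans _ (filter_subseq (pred1 g) s)).
  have /all_pred1P-> := filter_all (pred1 g) s.
  rewrite size_filter -(subnKC leg) nseqD; exact: prefix_subseq.
have sizeE : (\sum_(g : G) count_mem g s = size s)%N.
  elim: s {les few} => [|x s IHs]; first by rewrite big1.
  rewrite /= big_split /= IHs (bigD1 x) //= eqxx big1 // => g.
  by rewrite eq_sym => /negPf->.
have: (size s <= #|G| * n)%N.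
  rewrite -sizeE -sum_nat_const; apply: leq_sum => g _.
  by rewrite leqNgt few.
move=> /(leq_trans les); rewrite leqNgt mulnC ltn_mul //.
Qed.

Lemma exponent_mulrn (G : finZmodType) (g : G) : g *+ exponent [set: G] = 0.
Proof. by rewrite -FinRing.zmodXgE expg_exponent ?inE. Qed.

Lemma davenport_bound_ex (G : finZmodType) :
  exists m, `[< davenport_bound G m >].
Proof.
exists (exponent [set: G] * #|G|.+1)%N; apply/asboolP => s les.
have [g gs] := constant_subseq les.
exists (nseq (exponent [set: G]) g); split => //.
  by rewrite -size_eq0 size_nseq -lt0n exponent_gt0.
by rewrite big_nseq iter_addr_0 exponent_mulrn.
Qed.

Lemma weighted_bound_ex (G : finZmodType) (A : {fset int}) :
  A != fset0 -> exists m, `[< weighted_bound G A m >].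
Proof.
case/fset0Pn => a aA.
exists (exponent [set: G] * #|G|.+1)%N; apply/asboolP => s les.
have [g gs] := constant_subseq les.
exists (nseq (exponent [set: G]) g); split; rewrite ?size_nseq //.
exists (fun=> a); split=> //.
under eq_bigr => i _.
  rewrite nth_nseq; move: (ltn_ord i); rewrite [X in (_ < X)%N]size_nseq => ->.
  over.
rewrite sumr_const card_ord size_nseq pmulrn mulrzAC -pmulrn.
by rewrite exponent_mulrn mul0rz.
Qed.

Definition davenport (G : finZmodType) : nat := ex_minn (davenport_bound_ex G).

Definition weighted_const (G : finZmodType) (A : {fset int})
  (A0 : A != fset0) : nat := ex_minn (weighted_bound_ex G A0).

Definition dstar (p r : nat) (ks : r.-tuple nat) : nat :=
  (\sum_(t < r) (p ^ tnth ks t - 1))%N.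

(* The ceiling of the rational number m / d, for d > 0 *)
Definition ceildiv (m d : nat) : nat := ((m + d.-1) %/ d)%N.

Lemma leq_ceildiv (m d n : nat) :
  (0 < d)%N -> (ceildiv m d <= n)%N = (m <= n * d)%N.
Proof.
case: d => // d _.
by rewrite /ceildiv /= -ltnS ltn_divLR // mulSn (addnC m) addSn ltnS leq_add2l.
Qed.

(* Main.v *)
(* Let x_t = X^(e_t) - 1 in the group algebra of G over F_p, where e_1, ..., e_r
   are independent generators of orders p^(k_t).  As x_t^(p^(k_t)) = 0, the
   ideal J generated by the x_t (the augmentation ideal) satisfies
   J^(d*(G) + 1) = 0.  Since the elements of A are distinct modulo p, there are
   weights la_a in F_p such that f(c) = \sum_(a in A) la_a X^(a c) lies in
   1 + J^|A| for all c in G.  Let z be the generator of the second factor in the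
   group algebra of G x Z/p^k.  Each factor of \prod_i (1 - z f(c_i)) is 1 - z
   plus an element of J^|A|, and (1 - z)^(p^k) = 0, so the product vanishes when
   the sequence is long enough.  Its coefficient at 0 must then have
   contributions other than that of the empty subsequence: these are the
   A-weighted zero-sum subsequences of length divisible by p^k. *)

Require Import Defs.
From mathcomp Require Import all_boot all_order all_algebra all_fingroup.
From mathcomp Require Import all_solvable finmap.
From HB Require Import structures.
From mathcomp Require boolp.

Set Implicit Arguments.
Unset Strict Implicit.
Unset Printing Implicit Defensive.

Import GRing.Theory.

Local Open Scope nat_scope.

(** * Group algebra of a finite abelian group *)

Section GroupAlgebra.
Local Open Scope ring_scope.
Variables (K : comNzRingType) (H : finZmodType).

(** A name of its own keeps the additive structure of [{ffun H -> K}] and leaves the product free to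
    be convolution. *)
Definition group_algebra : Type := {ffun H -> K}.

HB.instance Definition _ := GRing.Zmodule.on group_algebra.

(** In the usual notation, c X^g. *)
Definition monomial (g : H) (c : K) : group_algebra :=
  [ffun h => if h == g then c else 0].

Definition convolution (x y : group_algebra) : group_algebra :=
  [ffun h => \sum_g x g * y (h - g)].

Fact convolutionC : commutative convolution.
Proof.
move=> x y; apply/ffunP => h; rewrite !ffunE.
rewrite (reindex_inj (inv_inj (subKr h))) /=.
by apply: eq_bigr => g _; rewrite subKr mulrC.
Qed.

Fact convolutionA : associative convolution.
Proof.
move=> x y z; apply/ffunP => h; rewrite !ffunE.
under eq_bigr => g _ do rewrite ffunE mulr_sumr.
under [RHS]eq_bigr => g _ do rewrite ffunE mulr_suml.
rewrite [RHS]exchange_big /=; apply: eq_bigr => g _.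
rewrite [RHS](reindex_inj (addrI g)) /=; apply: eq_bigr => k _.
by rewrite (addrC g) addrK mulrA opprD addrA addrAC.
Qed.

Lemma monomial_convolution c g x h :
  convolution (monomial g c) x h = c * x (h - g).
Proof.
rewrite ffunE (bigD1 g) //= ffunE eqxx big1 ?addr0 // => k /negPf kg.
by rewrite ffunE kg mul0r.
Qed.

Fact convolution1 : left_id (monomial 0 1) convolution.
Proof.
by move=> x; apply/ffunP => h; rewrite monomial_convolution mul1r subr0.
Qed.

Fact convolutionDl : left_distributive convolution +%R.
Proof.
move=> x y z; apply/ffunP => h; rewrite !ffunE -big_split /=.
by apply: eq_bigr => g _; rewrite ffunE mulrDl.
Qed.

Fact monomial01_neq0 : monomial 0 1 != 0 :> group_algebra.
Proof.
by apply/eqP => /ffunP/(_ 0); rewrite !ffunE eqxx => /eqP; rewrite oner_eq0.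
Qed.

HB.instance Definition _ := GRing.Zmodule_isComNzRing.Build group_algebra
  convolutionA convolutionC convolution1 convolutionDl monomial01_neq0.

Lemma monomial_mulE c g (x : group_algebra) h :
  (monomial g c * x) h = c * x (h - g).
Proof. exact: monomial_convolution. Qed.

Lemma monomialM c d g h :
  monomial (g + h) (c * d) = monomial g c * monomial h d.
Proof.
apply/ffunP => k; rewrite monomial_mulE !ffunE (addrC g).
by rewrite -(inj_eq (addIr (- g))) addrK; case: ifP => //; rewrite mulr0.
Qed.

Lemma monomial01 : monomial 0 1 = 1. Proof. by []. Qed.

Lemma monomial_is_nmod_morphism g : nmod_morphism (monomial g).
Proof.
split=> [|c d]; apply/ffunP => h; rewrite !ffunE ?if_same //.
by case: ifP => //; rewrite addr0.
Qed.

HB.instance Definition _ g :=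
  GRing.isNmodMorphism.Build K group_algebra (monomial g)
    (monomial_is_nmod_morphism g).

Lemma monomialX g n : monomial (g *+ n) 1 = monomial g 1 ^+ n.
Proof.
by elim: n => [|n IHn]; rewrite // mulrS exprS -IHn -monomialM mulr1.
Qed.

Lemma monomial_pchar p : p \in [pchar K]%R -> p \in [pchar group_algebra]%R.
Proof.
case/andP => p_pr /eqP p0; rewrite inE p_pr -monomial01.
by rewrite -(raddfMn (monomial 0)) p0 raddf0 eqxx.
Qed.

(** Frobenius: in characteristic p, (X^g - 1)^(p^k) + 1 = X^(p^k g) = 1. *)
Lemma subr1_monomialX p k g : p \in [pchar K]%R -> g *+ p ^ k = 0 ->
  (monomial g 1 - 1) ^+ (p ^ k) = 0.
Proof.
move=> /monomial_pchar pch g0.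
have pn : [pchar group_algebra].-nat (p ^ k)%N.
  rewrite pnatX; apply/orP; left.
  by rewrite pnatE ?(pcharf_prime pch) // pch.
have := exprDn_pchar (monomial g 1 - 1) 1 pn.
rewrite subrK expr1n -monomialX g0 monomial01 => /esym/eqP.
by rewrite addrC -subr_eq0 addrAC subrr add0r => /eqP.
Qed.

(* Comparing coefficients: the product differs from 1 only at sums of
   nonempty subsequences. *)
Lemma prod_monomial_support (T : eqType) (I : finType) (v : T -> I -> H)
    (mu : I -> K) (s : seq T) h :
  (\prod_(c <- s) (1 - \sum_i monomial (v c i) (mu i)) - 1 : group_algebra) h
    != 0 ->
  exists u : seq (T * I), [/\ subseq (unzip1 u) s, u != [::]
    & \sum_(x <- u) v x.1 x.2 = h].
Proof.
elim: s h => [|c s IHs] h; first by rewrite big_nil subrr ffunE eqxx.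
rewrite big_cons; set P := \prod_(_ <- _) _ in IHs *.
rewrite mulrBl mul1r mulr_suml addrAC ffunE.
(* The coefficient of [P - 1] at [h] covers the subsequences that skip [c]; the remaining term
   covers those that use it. *)
case: (eqVneq ((P - 1) h) 0) => [->|/IHs[u [us u0 uh]] _]; last first.
  by exists u; split=> //; apply: subseq_trans us (subseq_cons _ _).
rewrite add0r ffunE oppr_eq0 sum_ffunE => nz.
have [i] : exists i, (monomial (v c i) (mu i) * P) h != 0.
  apply/existsP; apply: contraR nz; rewrite negb_exists => /forallP z.
  by rewrite big1 // => i _; apply/eqP; have := z i; rewrite negbK.
rewrite monomial_mulE => nzi.
have {nzi} : P (h - v c i) != 0 by apply: contraNneq nzi => ->; rewrite mulr0.
(* Either the coefficient of [P] comes from 1, and [c] alone has sum [h], or [P - 1] contributes,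
   and [c] is put before the subsequence found for it. *)
case: (eqVneq ((P - 1) (h - v c i)) 0) => [|/IHs[u [us u0 uh]] _].
  rewrite ffunE [X in _ + X]ffunE => /eqP; rewrite subr_eq0 => /eqP ->.
  rewrite ffunE subr_eq0; case: (h =P v c i) => [->|_]; rewrite ?eqxx // => _.
  exists [:: (c, i)]; rewrite big_seq1; split=> //=.
  by rewrite eqxx sub0seq.
exists ((c, i) :: u); rewrite big_cons uh addrC subrK; split=> //=.
by rewrite eqxx.
Qed.

End GroupAlgebra.

(** * Powers of a finitely generated ideal *)

Section PowersOfIdeal.
Local Open Scope ring_scope.
Variables (C : comNzRingType) (r : nat) (x : 'I_r -> C).

(** Membership in J^n, where J is the ideal generated by the [x t]; peeling off one generator at a
    time suits induction on [n]. *)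
Fixpoint ideal_power (n : nat) (y : C) : Prop :=
  if n is n'.+1 then
    exists2 f : 'I_r -> C, y = \sum_t x t * f t & forall t, ideal_power n' (f t)
  else True.

Lemma ideal_power0 n : ideal_power n 0.
Proof.
elim: n => //= n IHn; exists (fun=> 0) => //.
by rewrite big1 // => t _; rewrite mulr0.
Qed.

Lemma ideal_powerD n y z :
  ideal_power n y -> ideal_power n z -> ideal_power n (y + z).
Proof.
elim: n y z => //= n IHn _ _ [f -> Hf] [g -> Hg].
exists (fun t => f t + g t) => [|t]; last exact: IHn.
by rewrite -big_split; apply: eq_bigr => t _; rewrite mulrDr.
Qed.

Lemma ideal_power_sum n (I : Type) (s : seq I) (P : pred I) F :
  (forall i, P i -> ideal_power n (F i)) ->
  ideal_power n (\sum_(i <- s | P i) F i).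
Proof.
move=> HF; elim/big_ind: _ => //; [exact: ideal_power0 | exact: ideal_powerD].
Qed.

Lemma ideal_powerM m n y z :
  ideal_power m y -> ideal_power n z -> ideal_power (m + n) (y * z).
Proof.
elim: m y z => [|m IHm] y z.
  move=> _; elim: n z => [//|n IHn] _ [f -> Hf].
  exists (fun t => y * f t) => [|t]; last exact: IHn (Hf t).
  by rewrite mulr_sumr; apply: eq_bigr => t _; rewrite mulrCA.
case=> f -> Hf Hz; exists (fun t => f t * z) => [|t]; last exact: IHm (Hf t) Hz.
by rewrite mulr_suml; apply: eq_bigr => t _; rewrite mulrA.
Qed.

Lemma ideal_powerMr n y z : ideal_power n y -> ideal_power n (y * z).
Proof. by move=> Hy; rewrite -(addn0 n); apply: ideal_powerM. Qed.

Lemma ideal_powerX n y : ideal_power 1 y -> ideal_power n (y ^+ n).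
Proof.
by move=> Hy; elim: n => // n IHn; rewrite exprS -add1n; exact: ideal_powerM.
Qed.

Lemma ideal_power_gen t : ideal_power 1 (x t).
Proof.
exists (fun u => (u == t)%:R) => //.
rewrite (bigD1 t) //= eqxx mulr1 big1 ?addr0 // => u /negPf->.
by rewrite mulr0.
Qed.

Lemma ideal_power_exprB1 y n :
  ideal_power 1 (y - 1) -> ideal_power 1 (y ^+ n - 1).
Proof.
by move=> Hy; rewrite subrX1; apply: ideal_powerMr.
Qed.

(** With [ideal_power_exprB1], this carries membership in 1 + J from the generators of a group to
    all its elements. *)
Lemma ideal_power_mulB1 y z : ideal_power 1 (y - 1) -> ideal_power 1 (z - 1) ->
  ideal_power 1 (y * z - 1).
Proof.
move=> Hy Hz; have -> : y * z - 1 = (y - 1) * z + (z - 1).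
  by rewrite mulrBl mul1r addrA subrK.
by apply: ideal_powerD => //; apply: ideal_powerMr.
Qed.

(** Pigeonhole: a monomial in the [x t] of degree above the sum of the [q t - 1] has, for some [t],
    an exponent at least [q t]. *)
Lemma ideal_power_eq0 (q : 'I_r -> nat) n y :
  (forall t, x t ^+ q t = 0) -> (\sum_t (q t - 1) < n)%N ->
  ideal_power n y -> y = 0.
Proof.
move=> xq0.
(* A monomial is carried along to collect the generators peeled off [y]. *)
suff: forall (m : 'I_r -> nat), ideal_power n y ->
    (\sum_t (q t - 1) < n + \sum_t m t)%N -> y * \prod_t x t ^+ m t = 0.
  move=> /(_ (fun=> 0%N)) gen lt_n Hy.
  have := gen Hy; rewrite big1_eq addn0 => /(_ lt_n).
  by rewrite big1 ?mulr1.
elim: n y => [|n IHn] y m.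
  move=> _ lt_m.
  have [t qm] : exists t, (q t <= m t)%N.
    apply/existsP; apply: contraLR lt_m; rewrite negb_exists => /forallP mq.
    rewrite -leqNgt; apply: leq_sum => t _.
    by have := mq t; rewrite -ltnNge subn1; case: (q t).
  rewrite (bigD1 t) //= -(subnK qm) exprD xq0.
  by rewrite mulr0 mul0r mulr0.
move=> [f -> Hf] lt_m; rewrite mulr_suml big1 // => t _.
pose m' u := (m u + (u == t))%N.
have m'E : (\sum_u m' u = (\sum_u m u).+1)%N.
  rewrite big_split /= (bigD1 t) //=.
  rewrite (bigD1 (F := fun i => (i == t) : nat) t) //= eqxx.
  by rewrite [X in (1 + X)%N]big1 ?addn1 // => u /negPf->.
have /= := IHn (f t) m' (Hf t); rewrite m'E addnS => /(_ lt_m) <-.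
rewrite -[x t * f t]mulrC -mulrA; congr (_ * _).
rewrite (bigD1 t) //= [RHS](bigD1 t) //= /m' eqxx addn1 exprS mulrA.
congr (_ * _).
by apply: eq_bigr => u /negPf->; rewrite addn0.
Qed.

(* In the expansion of the product, a term with Q factors [u] vanishes, and
   the other ones lie in a high power of the ideal. *)
Lemma prod_nilpotentD_eq0 (q : 'I_r -> nat) (u : C) Q d (T : Type) (s : seq T)
    (a : T -> C) :
  (forall t, x t ^+ q t = 0) -> u ^+ Q = 0 ->
  (forall c, ideal_power d (a c)) ->
  (\sum_t (q t - 1) < d * (size s + 1 - Q))%N ->
  \prod_(c <- s) (u + a c) = 0.
Proof.
move=> xq0 uQ0 Ha lt_s.
(* [j] counts the factors [u] chosen so far, and [b] gathers the chosen [a c]. At most [Q - 1]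
   factors can be [u], which leaves at least [size s + 1 - Q] in J^d. *)
suff gen j l b : ideal_power l b ->
    (\sum_t (q t - 1) < l + d * (size s + j + 1 - Q))%N ->
    b * u ^+ j * \prod_(c <- s) (u + a c) = 0.
  rewrite -(gen 0%N 0%N 1); rewrite ?expr0 ?mul1r //.
  by rewrite add0n addn0.
elim: s j l b {lt_s} => [|c s IHs] j l b Hb lt_l.
  have [Qj|jQ] := leqP Q j.
    by rewrite -(subnK Qj) exprD uQ0 !(mulr0, mul0r).
  rewrite add0n (_ : j + 1 - Q = 0)%N in lt_l;
    last by apply/eqP; rewrite subn_eq0 addn1.
  rewrite muln0 addn0 in lt_l.
  by rewrite (ideal_power_eq0 xq0 lt_l Hb) !mul0r.
rewrite big_cons mulrA mulrDr mulrDl -[_ * _ * u]mulrA -exprSr.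
rewrite (mulrAC b _ (a c)) (IHs j.+1 l b) //; last by rewrite (addnS (size s)).
rewrite (IHs j (l + d)%N) ?addr0 //; first exact: ideal_powerM.
(* Only an inequality, as the truncated subtraction may already be 0. *)
apply: leq_trans lt_l _; rewrite -(addnA l) leq_add2l -mulnS leq_mul2l /=.
by rewrite !addSn leq_subLR (addnS Q) ltnS -leq_subLR leqnn orbT.
Qed.

End PowersOfIdeal.

(** * Weights dual to binomial coefficients *)

Section DualWeights.
Local Open Scope ring_scope.

Lemma natr_ffact (R : comNzRingType) n j :
  (n ^_ j)%:R = \prod_(i < j) (n%:R - i%:R) :> R.
Proof.
have [jn|nj] := leqP j n.
  rewrite ffact_prod natr_prod; apply: eq_bigr => i _.
  by rewrite natrB // ltnW // (leq_trans (ltn_ord i)).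
by rewrite ffact_small // (bigD1 (Ordinal nj)) //= subrr mul0r.
Qed.

(* The weights [la i] are the Lagrange coefficients for interpolating at 0 from
   the nodes [a i]; C(., j) is a polynomial of degree j over F as j < p. *)
Lemma dual_weights (F : fieldType) p d (a : 'I_d -> nat) :
  p \in [pchar F] -> (d <= p)%N -> injective (fun i => (a i)%:R : F) ->
  exists la : 'I_d -> F, forall j, (j < d)%N ->
    \sum_i la i * ('C(a i, j))%:R = (j == 0%N)%:R.
Proof.
move=> pch dp a_inj.
pose V := Vandermonde d (\row_i (a i)%:R : 'rV[F]_d).
have V_unit : V \in unitmx.
  rewrite unitmxE det_Vandermonde unitfE; apply/prodf_neq0 => i _.
  apply/prodf_neq0 => j ij; rewrite !mxE subr_eq0 (inj_eq a_inj).
  by rewrite -val_eqE /= gtn_eqF.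
(* [w] solves the moment equations: the sum of the w_i a_i^l is 0^l for l < d. *)
pose w : 'cV[F]_d := invmx V *m \col_j (j == 0%N :> nat)%:R.
have Vw : V *m w = \col_j (j == 0%N :> nat)%:R by rewrite mulKVmx.
exists (w^~ 0) => j jd.
have VE l i : V l i = (a i)%:R ^+ l by rewrite !mxE.
have interp (q : {poly F}) : (size q <= d)%N ->
    \sum_i w i 0 * q.[(a i)%:R] = q.[0].
  move=> qd; under eq_bigr => i _ do rewrite (horner_coef_wide _ qd) mulr_sumr.
  rewrite exchange_big (horner_coef_wide _ qd); apply: eq_bigr => l _ /=.
  move/colP/(_ l): Vw; rewrite !mxE expr0n => <-; rewrite mulr_sumr.
  by apply: eq_bigr => i _; rewrite VE mulrCA [X in _ * X = _]mulrC.
have facE n :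
    (\prod_(i < j) ('X - i%:R%:P)).[n%:R] = ('C(n, j))%:R * (j`!)%:R :> F.
  rewrite -natrM bin_ffact natr_ffact horner_prod.
  by apply: eq_bigr => i _; rewrite hornerXsubC.
have j_neq0 : (j`!)%:R != 0 :> F.
  rewrite -(dvdn_pcharf pch) fact_prod; apply/negP.
  have p_pr := pcharf_prime pch.
  elim: j jd {facE} => [|l IHl] ld;
    first by rewrite big_geq // dvdn1 => /eqP p1; rewrite p1 in p_pr.
  rewrite big_nat_recr //= Euclid_dvdM // => /orP[|/dvdn_leq];
    first exact/IHl/ltnW.
  by move=> /(_ isT); rewrite leqNgt (leq_trans ld dp).
(* Multiplying by j! turns C(., j) into a falling factorial, a polynomial of size j + 1 <= d, so
   that [interp] applies. *)
apply: (mulIf j_neq0); rewrite mulr_suml.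
under eq_bigr => i _ do rewrite -mulrA -facE.
rewrite interp ?(facE 0%N) ?bin0n ?[j == 0%N]eq_sym //.
by rewrite size_prod_XsubC /index_enum -enumT size_enum_ord.
Qed.

(** The binomial expansion, cut at degree [d]: the later terms are multiples of y^d. *)
Lemma exprD1_ideal_power (C : comNzRingType) r (x : 'I_r -> C) y d n :
  ideal_power x 1 y ->
  ideal_power x d ((1 + y) ^+ n - \sum_(j < d) y ^+ j *+ 'C(n, j)).
Proof.
(* The range is widened so that it can be split at [d] even if [n < d]; the new coefficients C(n, j)
   vanish. *)
move=> Hy; rewrite exprDn (big_ord_widen_cond (d + n.+1) xpredT
  (fun j => (1 ^+ (n - j) * y ^+ j) *+ 'C(n, j))) ?leq_addl //.
have -> : \sum_(i < d + n.+1 | (i < n.+1)%N) (1 ^+ (n - i) * y ^+ i) *+ 'C(n, i)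
    = \sum_(i < d + n.+1) y ^+ i *+ 'C(n, i).
  rewrite big_mkcond; apply: eq_bigr => i _; rewrite expr1n mul1r.
  by case: ltnP => // ni; rewrite bin_small.
rewrite big_split_ord /= addrAC subrr add0r; apply: ideal_power_sum => i _.
by rewrite -mulr_natr exprD -mulrA; apply/ideal_powerMr/ideal_powerX.
Qed.

(** When X^(a g) = (1 + y)^a is expanded modulo J^d, the weights cancel the coefficient of y^j for 0
    < j < d and leave 1 for j = 0. *)
Lemma weighted_sum_ideal_power (K : comNzRingType) (H : finZmodType) r
    (x : 'I_r -> group_algebra K H) d (a : 'I_d -> nat) (la : 'I_d -> K) g :
  (0 < d)%N ->
  (forall j, (j < d)%N -> \sum_i la i * ('C(a i, j))%:R = (j == 0%N)%:R) ->
  ideal_power x 1 (monomial g 1 - 1) ->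
  ideal_power x d (\sum_i monomial (g *+ a i) (la i) - 1).
Proof.
move=> d_gt0 laP; set y := monomial g 1 - 1 => Hy.
have -> : 1 = \sum_i \sum_(j < d) monomial 0 (la i) * (y ^+ j *+ 'C(a i, j)).
  transitivity (\sum_(j < d) monomial 0 (j == 0%N :> nat)%:R * y ^+ j).
    rewrite (bigD1 (Ordinal d_gt0)) //= mulr1 big1 ?addr0 // => j.
    by rewrite -val_eqE /= => /negPf->; rewrite raddf0 mul0r.
  rewrite exchange_big; apply: eq_bigr => j _.
  rewrite -laP // raddf_sum mulr_suml; apply: eq_bigr => i _.
  by rewrite mulr_natr raddfMn mulrnAl mulrnAr.
rewrite -sumrB; apply: ideal_power_sum => i _.
have -> : monomial (g *+ a i) (la i) = monomial 0 (la i) * monomial g 1 ^+ a i.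
  by rewrite -monomialX -monomialM add0r mulr1.
rewrite -mulr_sumr -mulrBr mulrC -[monomial g 1](subrK 1) [_ - 1 + 1]addrC.
by apply: ideal_powerMr; apply: exprD1_ideal_power.
Qed.

End DualWeights.

(** * Product of an abelian group with a cyclic group *)

HB.instance Definition _ (G1 G2 : finZmodType) := Finite.on (G1 * G2)%type.

Section ProductWithCycle.
Local Open Scope ring_scope.
Variables (G : finZmodType) (n : nat).

Lemma pair0_mulrn (g : G) m : (g, 0 : 'I_n.+1) *+ m = (g *+ m, 0).
Proof.
by elim: m => // m IHm; rewrite !mulrS IHm; exact: congr2 erefl (addr0 _).
Qed.

Lemma sum_pair (V W : nmodType) (T : Type) (s : seq T) (F : T -> V)
    (F' : T -> W) :
  \sum_(x <- s) (F x, F' x) = (\sum_(x <- s) F x, \sum_(x <- s) F' x).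
Proof. by elim: s => [|x s IHs]; rewrite ?big_nil // !big_cons IHs. Qed.

(** [inZp 1] is a generator also when [n] is 0, a case that occurs for p^0. *)
Lemma Zp1_mulrn_eq0 m : (inZp 1 : 'I_n.+1) *+ m = 0 -> (n.+1 %| m)%N.
Proof.
by rewrite Zp_mulrn => /(congr1 val) /=; rewrite modnMml mul1n => /eqP.
Qed.

End ProductWithCycle.

(** * Weighted zero-sum subsequences of length divisible by p^k *)

(** The case k = 0 serves too: with A = {1} it bounds the Davenport constant from above. *)
Lemma weighted_subseq p (G : finZmodType) r (e : 'I_r -> G) (kt : 'I_r -> nat)
    (A : {fset int}) k (s : seq G) :
  prime p -> (forall t, e t *+ p ^ kt t = 0)%R ->
  (forall g, exists n : 'I_r -> nat, g = \sum_t e t *+ n t)%R ->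
  A != fset0 -> (forall a : int, a \in A -> (0 <= a)%R) ->
  (forall a b : int, a \in A -> b \in A -> a != b -> (a != b %[mod p])%Z) ->
  p ^ k - 1 + ceildiv (\sum_t (p ^ kt t - 1) + 1) #|` A| <= size s ->
  exists t : seq G,
    [/\ subseq t s, t != [::], weighted_zero_sum A t & p ^ k %| size t].
Proof.
move=> p_pr e0 e_gen A0 A_ge0 A_inj s_ge.
have d_gt0 : 0 < #|` A| by rewrite cardfs_gt0.
have pk_gt0 : 0 < p ^ k by rewrite expn_gt0 prime_gt0.
have pch := pchar_Fp p_pr.
set d := #|` A| in s_ge d_gt0 *.
pose wt (i : 'I_d) : int := nth 0%R A i.
have wtA i : wt i \in A by apply: mem_nth.
pose a i := `|wt i|%N.
have aE i : (a i)%:Z%R = wt i by rewrite gez0_abs // A_ge0.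
have a_inj : injective (fun i => (a i)%:R : 'F_p)%R.
  move=> i j /(congr1 val); rewrite /= !val_Fp_nat // => aij.
  apply: val_inj; apply/eqP;
    rewrite -(nth_uniq 0%R (ltn_ord i) (ltn_ord j) (fset_uniq A)).
  apply: contraT => /(A_inj _ _ (wtA i) (wtA j)).
  by rewrite -!aE !modz_nat aij eqxx.
have d_le_p : d <= p by rewrite -[d]card_ord -(card_Fp p_pr) (leq_card _ a_inj).
have [la laP] := dual_weights pch d_le_p a_inj.
(* Written [(p ^ k).-1.+1], the bound is visibly a successor, so that the ordinals form a group. *)
pose H : finZmodType := (G * 'I_(p ^ k).-1.+1)%type.
pose X (h : H) : group_algebra 'F_p H := monomial h 1%R.
pose z : H := (0%R, inZp 1).
pose x t : group_algebra 'F_p H := (X (e t, 0) - 1)%R.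
have xq0 t : (x t ^+ (p ^ kt t) = 0)%R.
  by apply: subr1_monomialX; rewrite ?pair0_mulrn ?e0.
have zq0 : ((1 - X z) ^+ (p ^ k) = 0)%R.
  rewrite -opprB exprNn subr1_monomialX ?mulr0 //; apply/eqP.
  have -> : (z *+ p ^ k = \sum_(i < p ^ k) (0, inZp 1) :> H)%R.
    by rewrite sumr_const card_ord.
  rewrite sum_pair big1 // sumr_const card_ord Zp_mulrn; apply/eqP;
    congr (_, _).
  by apply: val_inj; rewrite /= prednK // modnMl.
(* X^g is a product of powers of the X^(e_t), all in 1 + J. *)
have XG g : ideal_power x 1 (X (g, 0) - 1)%R.
  have [n ->] := e_gen g.
  have -> : (\sum_t e t *+ n t, 0)%R = (\sum_t (e t, 0) *+ n t : H)%R.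
    under [RHS]eq_bigr do rewrite pair0_mulrn.
    by rewrite (sum_pair _ (fun t => e t *+ n t)%R (fun=> 0%R)) big1_eq.
  elim/big_rec: _ => [|t h _ IHh].
    by rewrite /X monomial01 subrr; apply: ideal_power0.
  have -> : (X ((e t, 0) *+ n t + h) = X (e t, 0) ^+ n t * X h)%R.
    by rewrite /X -monomialX -monomialM mulr1.
  apply: ideal_power_mulB1 IHh; apply: ideal_power_exprB1.
  exact: (ideal_power_gen x t).
(* The first coordinate will give the weighted sum, the second the number of terms modulo p^k. *)
pose v (c : G) (i : 'I_d) : H := (c *+ a i, inZp 1)%R.
pose f c : group_algebra 'F_p H := (\sum_i monomial ((c, 0) *+ a i) (la i))%R.
have prod0 : (\prod_(c <- s) (1 - \sum_i monomial (v c i) (la i))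
    = 0 :> group_algebra 'F_p H)%R.
  under eq_bigr => c _.
    have -> : (1 - \sum_i monomial (v c i) (la i)
        = (1 - X z) + (f c - 1) * - X z)%R.
      rewrite mulrN mulrBl mul1r opprB addrA subrK /f mulr_suml;
        congr (1 - _)%R.
      apply: eq_bigr => i _; rewrite -monomialM mulr1 pair0_mulrn.
      by congr monomial; apply/esym; exact: congr2 (addr0 _) (add0r _).
    over.
  apply: (prod_nilpotentD_eq0 (d := d) xq0 zq0) => [c|].
    exact: ideal_powerMr (weighted_sum_ideal_power d_gt0 laP (XG c)).
  rewrite -addn1 mulnC -leq_ceildiv // -(leq_add2l (p ^ k - 1)).
  apply: leq_trans s_ge _.
  by rewrite -(leq_add2r 1) addnAC subnK // -leq_subLR.
(* As the product is 0, subtracting 1 leaves the coefficient -1 at 0. *)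
have nz1 : ((\prod_(c <- s) (1 - \sum_i monomial (v c i) (la i)) - 1
    : group_algebra 'F_p H) 0 != 0)%R.
  by rewrite prod0 sub0r -monomial01 !ffunE eqxx oppr_eq0 oner_eq0.
have [u [us u0]] := prod_monomial_support nz1.
rewrite (sum_pair _ (fun x => x.1 *+ a x.2)%R (fun=> inZp 1)) => -[u_sum /eqP].
rewrite big_const_seq count_predT iter_addr_0.
move=> /eqP/Zp1_mulrn_eq0; rewrite prednK // => pk_u.
(* A default for [nth], available because [u] is nonempty. *)
have x0 : G * 'I_d by case: u u0 {us u_sum pk_u}.
exists (unzip1 u); split;
  rewrite ?size_map // -?size_eq0 ?size_map ?size_eq0 //.
exists (fun i => wt (nth x0 u i).2); split=> //.
rewrite -[RHS]u_sum (big_nth x0) big_mkord size_map; apply: eq_bigr => i _.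
by rewrite (nth_map x0) // -aE pmulrn.
Qed.

(** * Independent generators and the Davenport constant *)

(** The generators are the images of the unit vectors. As [q t > 1], ['Z_(q t)] has exactly [q t]
    elements, which gives the divisibility criterion. *)
Lemma isog_cyclic_generators (G : finZmodType) r (q : 'I_r -> nat) :
  (forall t, 1 < q t) ->
  ([set: G] \isog [set: {dffun forall t : 'I_r, 'Z_(q t)}])%g ->
  exists2 e : 'I_r -> G,
    (forall g, exists n : 'I_r -> nat, g = \sum_t e t *+ n t)%R &
    forall n : 'I_r -> nat,
      (\sum_t e t *+ n t = 0)%R <-> (forall t, q t %| n t).
Proof.
move=> q_gt1; rewrite isog_sym => /isogP[h h_inj h_im].
pose e t := h (dfung1 (1%R : 'Z_(q t))).
pose y (n : 'I_r -> nat) : {dffun forall t : 'I_r, 'Z_(q t)} :=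
  finfun (fun t => (n t)%:R%R : 'Z_(q t)).
have eE n : (\sum_t e t *+ n t = h (y n))%R.
  have -> : y n = (\prod_t dfung1 ((n t)%:R%R : 'Z_(q t)))%g.
    apply/ffunP => t; rewrite prodg_ffun (big_only1 t) ?dfung1_id ?ffunE //.
    by move=> u ut _; rewrite dfung1_dflt.
  rewrite (big_morph h (id1 := 0%R) (op1 := +%R)) ?morph1 //; last first.
    by move=> a b; rewrite morphM ?inE.
  apply: eq_bigr => t _; rewrite -FinRing.zmodXgE -morphX ?inE //.
  congr (h _).
  by rewrite -(morphX (dfung1_morphism (fun t => 'Z_(q t) : finGroupType) t)) ?inE.
exists e => [g|n].
  have /morphimP[x _ _ ->] : g \in (h @* setT)%g by rewrite h_im inE.
  exists (fun t => val (x t)); rewrite eE; congr (h _).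
  by apply/ffunP => t; rewrite ffunE natr_Zp.
rewrite eE; split=> [h0 t|qn].
  have : y n = 1%g by apply: (injmP h_inj); rewrite ?inE // morph1.
  move/ffunP/(_ t); rewrite !ffunE => /(congr1 val) /=.
  by rewrite val_Zp_nat // => /eqP.
suff -> : y n = 1%g by rewrite morph1.
apply/ffunP => t; rewrite !ffunE; apply: val_inj; rewrite /= val_Zp_nat //.
exact/eqP/qn.
Qed.

Lemma sumr_count (V : nmodType) (I : finType) (e : I -> V) (u : seq I) :
  (\sum_(i <- u) e i = \sum_i e i *+ count_mem i u)%R.
Proof.
elim: u => [|j u IHu]; first by rewrite big_nil big1.
rewrite big_cons IHu /=; under [RHS]eq_bigr => i _ do rewrite mulrnDr.
rewrite big_split [X in _ = (X + _)%R](bigD1 j) //= eqxx.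
by rewrite [X in _ = (_ + X + _)%R]big1 ?addr0 // => i /negPf;
  rewrite eq_sym => ->.
Qed.

(** Taking each [e t] with multiplicity [q t - 1] gives a sequence without nonempty zero-sum
    subsequence. *)
Lemma davenport_lower (G : finZmodType) r (e : 'I_r -> G) (q : 'I_r -> nat) :
  (forall t, 0 < q t) ->
  (forall n : 'I_r -> nat, (\sum_t e t *+ n t = 0)%R -> forall t, q t %| n t) ->
  \sum_t (q t - 1) < davenport G.
Proof.
move=> q_gt0 e_free; rewrite /davenport;
  case: ex_minnP => m /boolp.asboolP Dm _.
rewrite ltnNge; apply/negP => mq.
(* Indices rather than elements of [G] keep the multiplicities apart even if some [e t] coincide. *)
pose s := flatten [seq nseq (q t - 1) t | t <- enum 'I_r].
have s_count t : count_mem t s = q t - 1.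
  rewrite count_flatten -map_comp sumnE big_map big_enum /= (bigD1 t) //=.
  rewrite count_nseq /= eqxx mul1n big1 ?addn0 // => u /negPf ut.
  by rewrite count_nseq /= ut.
have s_size : size s = \sum_t (q t - 1).
  rewrite size_flatten /shape -map_comp sumnE big_map big_enum /=.
  by apply: eq_bigr => t _; rewrite size_nseq.
have [|_ [/subseqP[b _ ->] + ]] := Dm (map e s);
  first by rewrite size_map s_size.
rewrite -map_mask big_map sumr_count; set u := mask b s => u0 /e_free qu.
(* The first index [t] of [u] occurs at least once and at most [q t - 1] times, yet [q t] divides
   its multiplicity. *)
case/eqP: u0; case u_eq: u => [//|t u'].
have u_ge : 0 < count_mem t u by rewrite u_eq /= eqxx.
have := dvdn_leq u_ge (qu t); rewrite leqNgt => /negP[].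
apply: leq_ltn_trans (_ : q t - 1 < _); last by rewrite subn1 prednK.
rewrite -s_count -!sum1_count; move: (mask_subseq b s); rewrite -/u.
by rewrite !sum1_count => /leq_count_subseq.
Qed.

(** * Value of the Davenport constant and bound on the weighted constant *)

Theorem theorem1p1 (p : nat) (G : finZmodType) (r : nat) (ks : r.-tuple nat)
    (A : {fset int})
    (p_pr : prime p)
    (pG : p.-group%g [set: G])
    (G_gt1 : 1 < #|G|)
    (ks_gt0 : forall t : 'I_r, 1 <= tnth ks t)
    (ks_sorted : sorted leq ks)
    (isoG : ([set: G] \isog
               [set: {dffun forall t : 'I_r, 'Z_(p ^ tnth ks t)}])%g)
    (A_neq0 : A != fset0)
    (A_range : forall a : int, a \in A ->
       (1 <= a <= (p ^ last 0%N ks)%:Z - 1)%R)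
    (A_ndvd : forall a : int, a \in A -> ~~ (p %| a)%Z)
    (A_incong : forall a b : int, a \in A -> b \in A -> a != b ->
       (a != b %[mod p])%Z) :
  (forall k : nat, 0 < k ->
     forall s : seq G,
       p ^ k - 1 + ceildiv (dstar p ks + 1) #|` A| <= size s ->
       exists t : seq G,
         [/\ subseq t s, t != [::], weighted_zero_sum A t & p ^ k %| size t])
  /\ davenport G = dstar p ks + 1
  /\ (r <= #|` A| -> dstar p ks <= #|` A| * (exponent [set: G] - 1))
  /\ (dstar p ks <= #|` A| * (exponent [set: G] - 1) ->
      weighted_const G A_neq0
        <= exponent [set: G] - 1 + ceildiv (davenport G) #|` A|).
Proof.
have q_gt1 t : 1 < p ^ tnth ks t.
  by rewrite -(expn0 p) ltn_exp2l ?prime_gt1 ?ks_gt0.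
have [e e_gen e_free] := isog_cyclic_generators q_gt1 isoG.
(* Independence, applied to coefficients supported at [t]. *)
have eX t n : (e t *+ n = 0)%R -> p ^ tnth ks t %| n.
  move=> en0; have /e_free/(_ t) : (\sum_u e u *+ (n * (u == t)) = 0)%R.
    rewrite big1 // => u _; case: eqP => [->|_]; first by rewrite muln1.
    by rewrite muln0.
  by rewrite eqxx muln1.
have e0 t : (e t *+ p ^ tnth ks t = 0)%R.
  have /e_free : forall u, p ^ tnth ks u %| p ^ tnth ks t * (u == t).
    by move=> u; case: eqP => [->|_]; rewrite ?muln1 ?muln0.
  rewrite (bigD1 t) //= eqxx muln1 big1 ?addr0 // => u /negPf->.
  by rewrite muln0.
have A_ge0 a : a \in A -> (0 <= a)%R.
  by case/A_range/andP => a1 _; apply: Order.POrderTheory.le_trans a1.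
have part1 k s := weighted_subseq (k := k) (s := s) p_pr e0 e_gen A_neq0 A_ge0
  A_incong.
have davE : davenport G = dstar p ks + 1.
  apply/eqP; rewrite addn1 eqn_leq; apply/andP; split.
  - (* the unweighted case: A = {1} and k = 0 *)
    rewrite /davenport; case: ex_minnP => m _; apply;
      apply/boolp.asboolP => s s_ge.
    have [] := weighted_subseq (A := [fset 1%R]%fset) (k := 0) (s := s) p_pr
      e0 e_gen.
    + by apply/fset0Pn; exists 1%R; rewrite inE.
    + by move=> a; rewrite inE => /eqP->.
    + by move=> a b; rewrite !inE => /eqP-> /eqP->; rewrite eqxx.
    + by rewrite cardfs1 expn0 subnn add0n /ceildiv divn1 addn0 addn1.
    move=> t [ts t0 [w [wA w0]] _]; exists t; split=> //.
    rewrite -[RHS]w0 (big_nth 0%R) big_mkord; apply: eq_bigr => i _.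
    by have := wA i; rewrite inE => /eqP->; rewrite mulr1z.
  - apply: (davenport_lower (e := e)) => [t|n /e_free //]; exact: ltnW.
have exp_ge t : p ^ tnth ks t <= exponent [set: G].
  by apply: dvdn_leq; rewrite ?exponent_gt0 //; apply/eX/exponent_mulrn.
have /p_natP[K expE] : p.-nat (exponent [set: G]) by rewrite pnat_exponent.
have A_gt0 : 0 < #|` A| by rewrite cardfs_gt0.
split; first by move=> k _ s; apply: part1.
split=> //; split=> [rA|dA].
  apply: leq_trans (_ : r * (exponent [set: G] - 1) <= _);
    last by rewrite leq_mul2r rA orbT.
  rewrite -[r in r * _]card_ord -sum_nat_const; apply: leq_sum => t _.
  exact: leq_sub2r.
rewrite davE /weighted_const; case: ex_minnP => m _; apply;
  apply/boolp.asboolP => s s_ge.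
(* Truncating to length exactly [N] will keep every subsequence shorter than twice the exponent. *)
set N := _ + _ in s_ge.
have N_size : size (take N s) = N by apply: size_takel.
have [|t [ts t0 tA]] := part1 K (take N s); first by rewrite N_size /N expE.
rewrite -expE => /dvdnP[j tj]; exists t; split=> //.
  exact: subseq_trans ts (take_subseq _ _).
have exp_gt0 : 0 < exponent [set: G] := exponent_gt0 _.
(* Here [dA] enters: d* + 1 <= |A| (exp - 1) + |A|. *)
have ceil_le : ceildiv (dstar p ks + 1) #|` A| <= exponent [set: G].
  rewrite leq_ceildiv // mulnC -(subnK exp_gt0) mulnDr muln1.
  exact: leq_add.
(* A nonzero multiple of the exponent below twice the exponent equals it. *)
have : j * exponent [set: G] < 2 * exponent [set: G].
  rewrite -tj (leq_ltn_trans (size_subseq ts)) // N_size /N mul2n -addnn.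
  by rewrite -addSn leq_add // subn1 prednK.
rewrite ltn_mul2r tj; case: j tj => [|[|j]]; rewrite ?mul1n ?andbF //.
by move=> /size0nil t_nil; rewrite t_nil in t0.
Qed.
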